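(* Let $G$ be a graph, let $t\geq 0$ be an integer, and let $H$ be the $t$-core of $G$. Suppose $H$ has maximum edge multiplicity at most $t+1$, and let $B$ be the underlying simple graph of the edges of $H$ of multiplicity exactly $t+1$. If $B$ has a full $B$-queue, then $\operatorname{cfan}(H)\leq t$.
   Context: A graph may have parallel edges but no loops. For a graph $J$ and vertices $x,y$, $\mu_J(x,y)$ is the number of edges of $J$ joining $x,y$; $\mu_J(v)=\max_u\mu_J(v,u)$; $d_J(v)$ is the degree of $v$ counting parallel edges; $N_J(x)$ is the neighbourhood of $x$; $\Delta(G)$ is the maximum degree. A subgraph may contain only some of the parallel copies of an edge. The $t$-core of $G$ is the subgraph induced by the vertices $v$ with $d_G(v)+\mu_G(v)>\Delta(G)+t$. Cfan number: for a graph $H$, a subgraph $K\subseteq H$ and an ordered pair $(x,y)$ with $xy\in E(K)$, $\operatorname{cdeg}_{H,K}(x,y)$ is the smallest nonnegative integer $l$ such that for all $Z\subseteq N_K(x)$ with $y\in Z$, $\sum_{z\in Z}(d_K(z)-d_H(z)+\mu_K(x,z)-l)\leq 1$; $\operatorname{cfan}(H)=\max_{K\subseteq H,\,E(K)\neq\emptyset}\min\{\operatorname{cdeg}_{H,K}(x,y): xy\in E(K)\}$, with $\operatorname{cfan}(H)=0$ if $H$ is edgeless. For a simple graph $B$, a $B$-queue is a sequence of vertices $(u_1,\ldots,u_q)$ together with vertex subsets $(S_0,\ldots,S_q)$ such that $S_0=\emptyset$ and for all $i\in\{1,\ldots,q\}$: $S_i=N_B(u_i)\cup\{u_i\}\cup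 S_{i-1}$; $1\leq|S_i\setminus S_{i-1}|\leq 2$; $u_i\notin\{u_1,\ldots,u_{i-1}\}$; and $|S_i\setminus(S_{i-1}\cup\{u_i\})|\leq 1$. It is full if $S_q=V(B)$. *)

(* Defs.v *)
From HB Require Import structures.
From mathcomp Require Import all_boot all_order all_algebra.

Set Implicit Arguments.
Unset Strict Implicit.
Unset Printing Implicit Defensive.

(* Finite loopless multigraphs: parallel edges are distinct elements of [edge]
   with the same two-element set of ends. *)
Record mgraph := MGraph {
  vertex : finType;
  edge : finType;
  ends : edge -> {set vertex};
  card_ends : forall e, #|ends e| = 2
}.

Arguments ends {m} e.

Record subgraph (G : mgraph) := Subgraph {
  sg_pair : {set vertex G} * {set edge G};
  sg_closed : [forall e in sg_pair.2, ends e \subset sg_pair.1]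
}.

HB.instance Definition _ G := [isSub for @sg_pair G].
HB.instance Definition _ G := [Finite of subgraph G by <:].

Section Subgraphs.

Variable G : mgraph.
Implicit Types (J H K : subgraph G) (x y v : vertex G) (A : {set vertex G}).

Definition verts J : {set vertex G} := (sg_pair J).1.
Definition edges J : {set edge G} := (sg_pair J).2.

Definition is_subgraph K H : bool :=
  (verts K \subset verts H) && (edges K \subset edges H).

Definition mu J x y : nat := #|[set e in edges J | ends e == [set x; y]]|.

Definition vmu J v : nat := \max_(u in verts J) mu J v u.

Definition max_mu J : nat := \max_(v in verts J) vmu J v.

Definition deg J v : nat := #|[set e in edges J | v \in ends e]|.

Definition max_deg J : nat := \max_(v in verts J) deg J v.

Definition nbhd J x : {set vertex G} := [set y | 0 < mu J x y].

Lemma whole_closed :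
  [forall e in ([set: vertex G], [set: edge G]).2,
     ends e \subset ([set: vertex G], [set: edge G]).1].
Proof. by apply/forall_inP => e _; apply: subsetT. Qed.

Definition whole : subgraph G := Subgraph whole_closed.

Lemma induced_closed A :
  [forall e in (A, [set e : edge G | ends e \subset A]).2,
     ends e \subset (A, [set e : edge G | ends e \subset A]).1].
Proof. by apply/forall_inP => e; rewrite inE. Qed.

Definition induced A : subgraph G := Subgraph (induced_closed A).

Definition tcore (t : nat) : subgraph G :=
  induced [set v | max_deg whole + t < deg whole v + vmu whole v].

Definition cdeg_bound H K x y (l : nat) : bool :=
  [forall Z : {set vertex G}, (Z \subset nbhd K x) && (y \in Z) ==>
    (\sum_(z in Z) ((deg K z)%:Z - (deg H z)%:Z + (mu K x z)%:Z - l%:Z)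
       <= 1 :> int)%R].

Lemma cdeg_bound_ex H K x y : exists l, cdeg_bound H K x y l.
Proof.
exists (\sum_z (deg K z + mu K x z)).
apply/forall_inP => Z _; apply: (@Order.POrderTheory.le_trans _ _ 0%R) => //.
rewrite -Num.Theory.oppr_ge0 -GRing.sumrN; apply: Num.Theory.sumr_ge0 => z _.
have h : deg K z + mu K x z <= \sum_z (deg K z + mu K x z).
  by rewrite (bigD1 z) //= leq_addr.
rewrite Num.Theory.oppr_ge0 Num.Theory.subr_le0.
rewrite GRing.addrAC -PoszD Num.Theory.lerBlDr -PoszD lez_nat.
exact: leq_trans h (leq_addr _ _).
Qed.

Definition cdeg H K x y : nat := ex_minn (cdeg_bound_ex H K x y).

End Subgraphs.

(* The minimum of [f] over [A]; the value 0 for empty [A] is a dummy. *)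
Definition min_over (T : finType) (A : {set T}) (f : T -> nat) : nat :=
  if [pick p in A] is Some p0 then f [arg min_(p < p0 in A) f p] else 0.

(* If [H] is edgeless, the maximum ranges over the empty family and is 0. *)
Definition cfan (G : mgraph) (H : subgraph G) : nat :=
  \max_(K : subgraph G | is_subgraph K H && (edges K != set0))
    min_over [set p : vertex G * vertex G | 0 < mu K p.1 p.2]
             (fun p => cdeg H K p.1 p.2).

Record sgraph (T : finType) := SGraph {
  sverts : {set T};
  sadj : rel T;
  sadj_sym : symmetric sadj;
  sadj_irr : irreflexive sadj;
  sadj_verts : forall x y, sadj x y -> x \in sverts
}.

Definition snbhd (T : finType) (B : sgraph T) (x : T) : {set T} :=
  [set y | sadj B x y].

(* Vertices are indexed from 0: with i : 'I_q, [u i] is the (i+1)-st vertex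
   and the two sets [S] below are those of index i+1 and i. *)
Definition is_queue (T : finType) (B : sgraph T) (q : nat)
    (u : 'I_q -> T) (S : 'I_q.+1 -> {set T}) : Prop :=
  [/\ forall i, u i \in sverts B,
      S ord0 = set0 &
      forall i : 'I_q,
        let Snew := S (lift ord0 i) in
        let Sold := S (widen_ord (leqnSn q) i) in
        [/\ Snew = snbhd B (u i) :|: [set u i] :|: Sold,
            1 <= #|Snew :\: Sold| <= 2,
            forall j : 'I_q, j < i -> u i != u j &
            #|Snew :\: (Sold :|: [set u i])| <= 1]].

Definition has_full_queue (T : finType) (B : sgraph T) : Prop :=
  exists (q : nat) (u : 'I_q -> T) (S : 'I_q.+1 -> {set T}),
    is_queue B u S /\ S ord_max = sverts B.

Section MultGraph.

Variables (G : mgraph) (J : subgraph G) (t : nat).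

Definition mult_adj : rel (vertex G) := fun x y => mu J x y == t.+1.

Lemma mult_adj_sym : symmetric mult_adj.
Proof. by move=> x y; rewrite /mult_adj /mu setUC. Qed.

Lemma mult_adj_irr : irreflexive mult_adj.
Proof.
move=> x; rewrite /mult_adj /mu (_ : [set e in _ | _] = set0) ?cards0 //.
apply/setP => e; rewrite !inE setUid; apply/negP => /andP[_ /eqP h].
by have := card_ends e; rewrite h cards1.
Qed.

Lemma mult_adj_verts x y : mult_adj x y -> x \in verts J.
Proof.
move=> /eqP h; have : 0 < mu J x y by rewrite h.
rewrite card_gt0 => /set0Pn[e]; rewrite inE => /andP[eJ /eqP he].
have /forall_inP/(_ e eJ)/subsetP := sg_closed J; apply.
by rewrite he !inE eqxx.
Qed.

(* The simple graph of the edges of multiplicity exactly t+1, taken as a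
   spanning graph: its vertex set is that of [J]. *)
Definition mult_graph : sgraph (vertex G) :=
  SGraph mult_adj_sym mult_adj_irr mult_adj_verts.

End MultGraph.

(* Main.v *)
Require Import Defs.
From mathcomp Require Import all_boot.
From mathcomp Require Import all_order all_algebra zify.

(** In the sum defining [cdeg] at [l = t], the term of [z] is at most 1, with
    equality only if [K] contains all edges of [H] at [z] and [z] is a
    [B]-neighbour of [x].  So it suffices to find a vertex [x], not isolated in
    [K], with at most one such "saturated" [B]-neighbour.  Take [x = u_i] where
    [S_i] is the first set of the queue that meets the set of saturated
    non-isolated vertices: the saturated neighbours of [u_i] all lie in
    [S_i \ (S_{i-1} U {u_i})], and [u_i] is not isolated, being saturated itself
    or joined by an edge of [H] to a saturated vertex.  If no such set exists,
    any non-isolated [x] works. *)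

Set Implicit Arguments.
Unset Strict Implicit.
Unset Printing Implicit Defensive.

Lemma min_over_le (T : finType) (A : {set T}) (f : T -> nat) (p : T) (m : nat) :
  p \in A -> f p <= m -> min_over A f <= m.
Proof.
move=> pA fp; rewrite /min_over; case: pickP => [p0 p0A|_ //].
by case: arg_minnP => // i _ /(_ p pA) fi; apply: leq_trans fi fp.
Qed.

Lemma full_queue_few_neighbours (T : finType) (B : sgraph T) (D : {set T}) :
  has_full_queue B -> D \subset sverts B -> D != set0 ->
  exists2 x, x \in D \/ (exists2 z, z \in D & sadj B x z)
           & #|snbhd B x :&: D| <= 1.
Proof.
move=> [q [u [S [[_ S0 qS] Sfull]]]] /setIidPl DB D0.
have : D :&: S ord_max != set0 by rewrite Sfull DB.
(* [j] is the least index whose set meets [D]; it is positive because [S ord0] is empty, so it is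
   the successor of some queue index [i]. *)
case/(@arg_minnP _ _ (fun i => D :&: S i != set0) (@nat_of_ord _)) => j.
case: (unliftP ord0 j) => [i ->|->]; last by rewrite S0 setI0 eqxx.
move=> Snew Smin; case: (qS i) => Snew_def _ _ new_le1.
have Sold : [disjoint D & S (widen_ord (leqnSn q) i)].
  rewrite -setI_eq0; apply/negPn/negP => /Smin /=.
  by rewrite /bump leq0n ltnn.
exists (u i).
  case/set0Pn: Snew => z; rewrite inE Snew_def => /andP[zD].
  rewrite !inE (disjointFr Sold zD) orbF => /orP[uz|/eqP <-]; last by left.
  by right; exists z.
apply: leq_trans new_le1; apply/subset_leq_card/subsetP => z.
rewrite Snew_def !inE => /andP[uz zD].
rewrite uz (disjointFr Sold zD) /= andbT.
(* [z] differs from [u i] because [B] has no loops. *)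
by apply: contraTneq uz => ->; rewrite sadj_irr.
Qed.

Section Subgraphs.

Variables (G : mgraph).
Implicit Types (H K : subgraph G) (x y z : vertex G).

Lemma muC K x y : mu K x y = mu K y x.
Proof. by rewrite /mu setUC. Qed.

Lemma mu_le_deg K x y : mu K x y <= deg K y.
Proof.
apply/subset_leq_card/subsetP => e; rewrite !inE => /andP[-> /eqP ->].
by rewrite !inE eqxx orbT.
Qed.

Lemma mu_sub K H x y : is_subgraph K H -> mu K x y <= mu H x y.
Proof.
case/andP=> _ /subsetP KH; apply/subset_leq_card/subsetP => e.
by rewrite !inE => /andP[/KH -> ->].
Qed.

Lemma deg_sub K H x : is_subgraph K H -> deg K x <= deg H x.
Proof.
case/andP=> _ /subsetP KH; apply/subset_leq_card/subsetP => e.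
by rewrite !inE => /andP[/KH -> ->].
Qed.

Lemma mu_verts K x y : 0 < mu K x y -> x \in verts K.
Proof.
case/card_gt0P=> e; rewrite inE => /andP[eK /eqP he].
have /forall_inP/(_ e eK)/subsetP := sg_closed K; apply.
by rewrite he !inE eqxx.
Qed.

Lemma mu_max_mu K x y : mu K x y <= max_mu K.
Proof.
have [->//|mu_gt0] := posnP (mu K x y).
apply: (@leq_trans (vmu K x)).
  by apply: leq_bigmax_cond; apply: (@mu_verts _ _ x); rewrite muC.
exact: leq_bigmax_cond (mu_verts mu_gt0).
Qed.

Lemma edge_mu K e x : e \in edges K -> x \in ends e -> exists y, 0 < mu K x y.
Proof.
move=> eK xe; have /cards2P [a [b [_ he]]] : #|ends e| == 2 by rewrite card_ends.
have ab_gt0 : 0 < mu K a b by apply/card_gt0P; exists e; rewrite inE eK he eqxx.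
by move: xe; rewrite he !inE => /orP[]/eqP->; [exists b | exists a; rewrite muC].
Qed.

Lemma deg_mu K x : 0 < deg K x -> exists y, 0 < mu K x y.
Proof.
by case/card_gt0P=> e; rewrite inE => /andP[]; apply: edge_mu.
Qed.

(** The edges of [K] at [z] lie among those of [H] at [z], and equal counts make the two sets
    coincide. *)
Lemma saturated_mu K H x z :
  is_subgraph K H -> deg K z = deg H z -> mu K x z = mu H x z.
Proof.
move=> /andP[_ KH] dz.
have /eqP sat : [set e in edges K | z \in ends e]
             == [set e in edges H | z \in ends e].
  rewrite eqEcard -/(deg K z) -/(deg H z) dz leqnn andbT.
  by apply/subsetP => e; rewrite !inE => /andP[/(subsetP KH) -> ->].
apply: eq_card => e; rewrite !inE.
have [he|] := eqVneq (ends e) [set x; z]; last by rewrite !andbF.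
by have /setP/(_ e) := sat; rewrite !inE he !inE eqxx orbT !andbT.
Qed.

Lemma cdeg_le K H x y l : cdeg_bound H K x y l -> cdeg H K x y <= l.
Proof. by rewrite /cdeg; case: ex_minnP => m _; apply. Qed.

Lemma cdeg_le_few_saturated K H t x y :
  is_subgraph K H -> max_mu H <= t.+1 ->
  #|snbhd (mult_graph H t) x :&: [set z | deg K z == deg H z]| <= 1 ->
  cdeg H K x y <= t.
Proof.
set D := _ :&: _ => KH Ht D_le1; apply: cdeg_le.
apply/forall_inP => Z _.
(* A term is positive only if no edge is lost at [z] and [mu K x z] is [t+1]; then [mu H x z] is
   [t+1] as well, so [z] lies in [D]. *)
apply: (@Order.POrderTheory.le_trans _ _ (\sum_(z in Z) (z \in D)%:Z)%R).
  apply: Num.Theory.ler_sum => z _; rewrite !inE /= /mult_adj.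
  have dz := deg_sub z KH; have mz := mu_sub x z KH.
  have mt := leq_trans (mu_max_mu H x z) Ht.
  by lia.
have -> : (\sum_(z in Z) (z \in D)%:Z)%R = Posz (\sum_(z in Z) (z \in D)).
  by rewrite -(big_morph Posz PoszD (erefl _)).
rewrite lez_nat -big_mkcondr /= sum1_card; apply: leq_trans D_le1.
by apply/subset_leq_card/subsetP => z /andP[].
Qed.

Lemma exists_few_saturated K H t :
  is_subgraph K H -> edges K != set0 -> has_full_queue (mult_graph H t) ->
  exists2 x, exists y, 0 < mu K x y
    & #|snbhd (mult_graph H t) x :&: [set z | deg K z == deg H z]| <= 1.
Proof.
move=> KH K0 qB; set B := mult_graph H t.
pose D := [set z | (deg K z == deg H z) && (0 < deg K z)].
(* A [B]-neighbour has degree at least [t+1] in [H], so a saturated one cannot be isolated in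
   [K]. *)
have nbhdD x : snbhd B x :&: [set z | deg K z == deg H z] = snbhd B x :&: D.
  apply/setP => z; rewrite !inE /= /mult_adj.
  case: eqP => //= xz; case: eqP => //= ->.
  by rewrite (leq_trans _ (mu_le_deg H x z)) ?xz.
have [D0|D0] := eqVneq D set0.
  case/set0Pn: K0 => e eK.
  have /card_gt0P[x xe] : 0 < #|ends e| by rewrite card_ends.
  by exists x; [apply: edge_mu eK xe | rewrite nbhdD D0 setI0 cards0].
have DB : D \subset sverts B.
  apply/subsetP => z; rewrite inE => /andP[_ /deg_mu[y yz]].
  by case/andP: KH => /subsetP KHv _; apply: KHv; apply: mu_verts yz.
have [x xD x_le1] := full_queue_few_neighbours qB DB D0.
exists x; last by rewrite nbhdD.
(* If [x] is [B]-adjacent to some [z] in [D], saturation of [z] puts all [t+1] edges of [H] between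
   [x] and [z] into [K]. *)
case: xD => [|[z]]; first by rewrite inE => /andP[_ /deg_mu].
rewrite inE => /andP[/eqP dz _] /eqP xz.
by exists z; rewrite (saturated_mu x KH dz) xz.
Qed.

End Subgraphs.

Theorem theorem3p1 (G : mgraph) (t : nat) :
  max_mu (tcore G t) <= t.+1 ->
  has_full_queue (mult_graph (tcore G t) t) ->
  cfan (tcore G t) <= t.
Proof.
move=> Ht qB; apply/bigmax_leqP => K /andP[KH K0].
have [x [y xy] x_le1] := exists_few_saturated KH K0 qB.
(* The bound on [cdeg] depends only on [x], so any [K]-neighbour [y] serves. *)
apply: (@min_over_le _ _ _ (x, y)); first by rewrite inE.
exact: cdeg_le_few_saturated KH Ht x_le1.
Qed.
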